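(* Let $\alpha,\beta>-1$. The Jacobi measure $J^{\alpha,\beta}(dx)=(1-x)^{\alpha}(1+x)^{\beta}\,dx$ on $[-1,1]$ is a doubling measure.
   Context: A measure $\mu$ on $[-1,1]$ is doubling if there is a constant $C$ such that $\mu([x-2t,x+2t]\cap[-1,1])\le C\,\mu([x-t,x+t]\cap[-1,1])$ for all $x\in[-1,1]$ and $t>0$. *)

(* Defs.v *)
From HB Require Import structures.
From mathcomp Require Import all_boot all_order all_algebra.
From mathcomp Require Import all_classical all_reals all_analysis.
From mathcomp Require Import measurable_realfun.

Set Implicit Arguments.
Unset Strict Implicit.
Unset Printing Implicit Defensive.

Import Order.TTheory GRing.Theory Num.Def Num.Theory.
Import numFieldTopology.Exports.

Local Open Scope classical_set_scope.
Local Open Scope ring_scope.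

(* A measure on [-1, 1] is represented by a Borel measure on the line; only its
   trace on [-1, 1] matters here. *)
Definition doubling (R : realType)
    (mu : {measure set R -> \bar R}) : Prop :=
  exists C : R, forall x t : R, x \in `[-1, 1] -> 0 < t ->
    (mu (`[(x - 2 * t)%R, (x + 2 * t)%R] `&` `[(-1)%R, 1%R]) <=
     C%:E * mu (`[(x - t)%R, (x + t)%R] `&` `[(-1)%R, 1%R]))%E.

(* Since 0 `^ a = 0 for a <> 0, the weight is 0 instead of +oo at an endpoint
   with a negative exponent; this only concerns a Lebesgue-null set. *)
Definition jacobi_weight (R : realType) (alpha beta x : R) : R :=
  (1 - x) `^ alpha * (1 + x) `^ beta.

(* J^{alpha,beta}, extended by zero outside [-1, 1]. *)
Definition jacobi (R : realType) (alpha beta : R)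
    (A : set R) : \bar R :=
  (\int[lebesgue_measure]_(x in A `&` `[(-1)%R, 1%R])
     (jacobi_weight alpha beta x)%:E)%E.

Section jacobi_measure.
Context (R : realType) (alpha beta : R).

Lemma jacobi_weight_ge0 (x : R) : 0 <= jacobi_weight alpha beta x.
Proof. by rewrite /jacobi_weight mulr_ge0// powR_ge0. Qed.

Lemma measurable_jacobi_weight :
  measurable_fun [set: R] (jacobi_weight alpha beta).
Proof.
apply: measurable_funM.
- apply: (measurableT_comp (measurable_powR alpha)).
  exact: measurable_funB.
- apply: (measurableT_comp (measurable_powR beta)).
  exact: measurable_funD.
Qed.

Let jacobi0 : jacobi alpha beta set0 = 0%E.
Proof. by rewrite /jacobi set0I integral_set0. Qed.

Let jacobi_ge0 A : (0 <= jacobi alpha beta A)%E.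
Proof.
by apply: integral_ge0 => x _; rewrite lee_fin jacobi_weight_ge0.
Qed.

Let jacobi_sigma_additive : semi_sigma_additive (jacobi alpha beta).
Proof.
move=> /= F mF tF mUF; rewrite /jacobi setI_bigcupl.
have mI : measurable (`[(-1)%R, 1%R] : set R) by exact: measurable_itv.
apply: (@semi_sigma_additive_nng_induced _ _ R lebesgue_measure
  (EFin \o jacobi_weight alpha beta)) => //.
- by apply/measurable_EFinP; exact: measurable_jacobi_weight.
- by move=> x; rewrite lee_fin jacobi_weight_ge0.
- by move=> i; exact: (measurableI _ _ (mF i) mI).
- exact: (@trivIset_setIr R nat setT F (fun=> _) tF).
- by rewrite -setI_bigcupl; exact: (measurableI _ _ mUF mI).
Qed.

HB.instance Definition _ := isMeasure.Build _ _ _ (jacobi alpha beta)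
  jacobi0 jacobi_ge0 jacobi_sigma_additive.

End jacobi_measure.

(* Main.v *)
(* For x in [0, 1] and t <= 1/2 the factor (1 + y)^beta is comparable to 1 on the
   ball B(x, t), and J(B(x, t)) is comparable to t (1 - x + t)^alpha, a quantity
   that at most changes by a constant factor when t is doubled.  The lower bound
   is pointwise on [x - t, x - t/2]; the upper bound is pointwise when
   alpha >= 0, and when alpha < 0 it comes from the primitive of (1 - y)^alpha.
   For t > 1/4 the measure of B(x, 2t) is at most the finite total mass and that
   of B(x, t) is at least that of B(x, 1/4).  The case x < 0 follows by the
   reflection y -> -y, which exchanges alpha and beta. *)

Require Import Defs.
From HB Require Import structures.
From mathcomp Require Import all_boot all_order all_algebra.
From mathcomp Require Import all_classical all_reals all_analysis.
From mathcomp Require Import measurable_realfun.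
From mathcomp Require Import ring lra.

Import Order.TTheory GRing.Theory Num.Def Num.Theory.
Import numFieldTopology.Exports numFieldNormedType.Exports.

Local Open Scope ring_scope.
Local Open Scope classical_set_scope.

(** * Comparison of real powers *)

(** For [a >= 0] raise [u <= L * v] to the power [a]; for [a < 0] raise [v <= L * u] to the power
    [- a] and invert. The exponent [|a|] lets one constant serve both signs. *)
Lemma powR_le_comparable (R : realType) (a L u v : R) :
  0 < u -> 0 < v -> 1 <= L -> u <= L * v -> v <= L * u ->
  u `^ a <= L `^ `|a| * v `^ a.
Proof.
move=> u0 v0 L1 uLv vLu; have L0 : 0 < L by lra.
have powR_homo (b x y : R) : 0 <= b -> 0 < x -> x <= y -> x `^ b <= y `^ b.
  move=> b0 x0 xy; apply: ge0_ler_powR => //; rewrite nnegrE ltW//.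
  exact: lt_le_trans xy.
have [a0|a0] := leP 0 a.
  by rewrite ger0_norm// -(powRM _ (ltW L0) (ltW v0)) powR_homo.
rewrite ltr0_norm// -[a in v `^ a]opprK -[a in u `^ a]opprK !(powRN _ (- a)).
rewrite ler_pdivlMr ?powR_gt0// mulrC ler_pdivrMr ?powR_gt0//.
by rewrite -(powRM _ (ltW L0) (ltW u0)) powR_homo// oppr_ge0 ltW.
Qed.

(** * Integrals of powers of the distance to the endpoint 1 *)

Section integral_powR.
Context (R : realType).
Notation mu := (@lebesgue_measure R).

Lemma measurable_powR_onem (a : R) (D : set R) :
  measurable_fun D (fun y : R => ((1 - y) `^ a)%:E).
Proof.
apply: measurable_funTS; apply/measurable_EFinP.
apply: (measurableT_comp (measurable_powR a)).
exact: measurable_funB.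
Qed.

Lemma is_derive_powR_onem (a y : R) : y < 1 ->
  is_derive y 1 (fun z : R => (1 - z) `^ a) (- (a * (1 - y) `^ (a - 1))).
Proof.
move=> y1; have y0 : 0 < 1 - y by lra.
have d1 : is_derive y 1 (fun z : R => 1 - z) (-1).
  apply: is_derive_eq (is_deriveB (is_derive_cst _ _ _) (is_derive_id _ _)) _.
  by rewrite sub0r.
apply: is_derive_eq (@is_derive1_comp R (@powR R ^~ a) (fun z : R => 1 - z) y _ _
  (@is_derive1_powR R a _ y0) d1) _.
by rewrite mulrN1.
Qed.

Lemma continuous_powR_onem (a y : R) : y < 1 ->
  {for y, continuous (fun z : R => (1 - z) `^ a)}.
Proof.
move=> y1; apply: differentiable_continuous; apply/derivable1_diffP.
by have [] := is_derive_powR_onem a y y1.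
Qed.

Lemma integral_powR_onem (a p q : R) : -1 < a -> p < q -> q < 1 ->
  (\int[mu]_(y in `[p, q]) ((1 - y) `^ a)%:E =
   ((a + 1)^-1 * ((1 - p) `^ (a + 1) - (1 - q) `^ (a + 1)))%:E)%E.
Proof.
move=> a1 pq q1.
pose F z : R := - (a + 1)^-1 * (1 - z) `^ (a + 1).
have dF (y : R) : y < 1 -> is_derive y 1 F ((1 - y) `^ a).
  move=> y1; apply: is_derive_eq (is_deriveZ _ (is_derive_powR_onem _ _ y1)) _.
  by rewrite /GRing.scale/= addrK; field; lra.
have cF (y : R) : y < 1 -> {for y, continuous F}.
  move=> y1; apply: differentiable_continuous; apply/derivable1_diffP.
  by have [] := dF y y1.
rewrite (@continuous_FTC2 _ _ F)//.
- by rewrite -EFinB; congr EFin; rewrite /F; ring.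
- apply: continuous_in_subspaceT => y /[!inE]/= /[!in_itv]/= /andP[_ yq].
  by apply: continuous_powR_onem; lra.
- split.
  + by move=> y /[!in_itv]/= /andP[_ yq]; have [] := dF y (lt_trans yq q1).
  + by apply: cvg_at_right_filter; apply: cF; lra.
  + by apply: cvg_at_left_filter; apply: cF; lra.
- move=> y /[!in_itv]/= /andP[_ yq]; rewrite derive1E.
  by have [] := dF y (lt_trans yq q1).
Qed.

Lemma integral_cst_itv (p q c : R) : p <= q ->
  (\int[mu]_(y in `[p, q]) c%:E = (c * (q - p))%:E)%E.
Proof.
rewrite le_eqVlt => /predU1P[<-|pq].
  by rewrite set_itv1 integral_set1 subrr mulr0.
rewrite (integral_cst mu _ c%:E)//=.
by rewrite lebesgue_measure_itv/= lte_fin pq -EFinB -EFinM.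
Qed.

Let powR_onem_ge0 (a y : R) : (0 <= ((1 - y) `^ a)%:E)%E.
Proof. by rewrite lee_fin powR_ge0. Qed.

(* As a < 0, (1 - q)^(a + 1) >= (1 - q) (1 - p)^a. *)
Let integral_powR_onem_lt1 (a p q : R) : -1 < a < 0 -> p < q -> q < 1 ->
  (\int[mu]_(y in `[p, q]) ((1 - y) `^ a)%:E <=
   ((a + 1)^-1 * ((q - p) * (1 - p) `^ a))%:E)%E.
Proof.
move=> /andP[a1 a0] pq q1.
rewrite integral_powR_onem// lee_fin ler_pM2l ?invr_gt0; last lra.
rewrite (powRD (x := 1 - p)) ?subr_eq0; last by apply/implyP => _; lra.
rewrite (powRD (x := 1 - q)) ?subr_eq0; last by apply/implyP => _; lra.
rewrite !powRr1; [|lra|lra].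
suff : (1 - p) `^ a * (1 - q) <= (1 - q) `^ a * (1 - q) by lra.
rewrite ler_pM2r; last lra.
rewrite -[a]opprK !(powRN _ (- a)) lef_pV2 ?posrE ?powR_gt0; try lra.
by apply: ge0_ler_powR; rewrite ?nnegrE; lra.
Qed.

(* The integrand is unbounded at 1: exhaust [p, 1[ by segments [p, 1 - 1/n]. *)
Let integral_powR_onem_le1 (a p : R) : -1 < a < 0 -> p < 1 ->
  (\int[mu]_(y in `[p, 1%R]) ((1 - y) `^ a)%:E <=
   ((a + 1)^-1 * ((1 - p) * (1 - p) `^ a))%:E)%E.
Proof.
move=> a01 p1.
rewrite -integral_itv_bndo_bndc//; last exact: measurable_powR_onem.
have a10 : 0 <= (a + 1)^-1 by rewrite invr_ge0; lra.
rewrite itv_bnd_open_bigcup.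
apply: cvge_le (ge0_nondecreasing_set_cvg_integral _ _ _ _) => //.
- apply: nearW => n; have : 0 < n.+1%:R^-1 :> R by rewrite invr_gt0.
  move: n.+1%:R^-1 => e e0.
  have [pq|qp] := ltP p (1 - e).
    have q1 : 1 - e < 1 by lra.
    apply: le_trans (integral_powR_onem_lt1 a _ _ a01 pq q1) _.
    by rewrite lee_fin ler_wpM2l// ler_wpM2r ?powR_ge0//; lra.
  (* Here [1 - e <= p], so the segment is empty or reduced to [p] and its integral vanishes. *)
  apply: (@le_trans _ _ (\int[mu]_(y in [set p]) ((1 - y) `^ a)%:E)%E).
    apply: ge0_subset_integral => //; first exact: measurable_powR_onem.
    move=> y /=; rewrite in_itv/= => /andP[py yq].
    by apply/eqP; rewrite eq_le; lra.
  by rewrite integral_set1 lee_fin mulr_ge0// mulr_ge0 ?powR_ge0//; lra.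
- move=> m n mn; rewrite subsetEset => y /=; rewrite !in_itv/= => /andP[-> yq].
  apply: le_trans yq _; rewrite lerD2l lerN2 lef_pV2 ?posrE//.
  by rewrite ler_nat.
- by move=> n; exact: measurable_powR_onem.
Qed.

(** For [a >= 0] the integrand is largest at [p], which gives the factor 1; for [a < 0] the
    primitive gives the factor [(a + 1)^-1]. The sum of the two covers both signs. *)
Lemma integral_powR_onem_le (a p q : R) : -1 < a -> p < q -> q <= 1 ->
  (\int[mu]_(y in `[p, q]) ((1 - y) `^ a)%:E <=
   ((1 + (a + 1)^-1) * ((q - p) * (1 - p) `^ a))%:E)%E.
Proof.
move=> a1 pq q1; have a10 : 0 <= (a + 1)^-1 by rewrite invr_ge0; lra.
have [a0|a0] := leP 0 a.
  apply: (@le_trans _ _ ((1 - p) `^ a * (q - p))%:E).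
    rewrite -(integral_cst_itv _ _ _ (ltW pq)); apply: ge0_le_integral => //.
    - exact: measurable_powR_onem.
    - move=> y /=; rewrite in_itv/= => /andP[py yq]; rewrite lee_fin.
      by apply: ge0_ler_powR; rewrite ?nnegrE; lra.
  rewrite lee_fin mulrC ler_peMl//; last lra.
  by rewrite mulr_ge0 ?powR_ge0//; lra.
apply: (@le_trans _ _ ((a + 1)^-1 * ((q - p) * (1 - p) `^ a))%:E); last first.
  rewrite lee_fin ler_wpM2r ?mulr_ge0 ?powR_ge0//; lra.
have a01 : -1 < a < 0 by rewrite a1.
have [q1'|q1'|q1'] := ltgtP q 1; first exact: integral_powR_onem_lt1.
  by rewrite leNgt q1' in q1.
by move: pq; rewrite q1'; exact: integral_powR_onem_le1.
Qed.

End integral_powR.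

(** * Two-sided estimates of the Jacobi measure of balls *)

Section jacobi_balls.
Context (R : realType).
Implicit Types alpha beta x t : R.
Notation mu := (@lebesgue_measure R).

Definition ball11 x t : set R := `[x - t, x + t] `&` `[-1, 1].

Lemma measurable_ball11 x t : measurable (ball11 x t).
Proof. exact: measurableI. Qed.
#[local] Hint Resolve measurable_ball11 : core.

Let measurable_weight alpha beta (D : set R) :
  measurable_fun D (fun y => (jacobi_weight alpha beta y)%:E).
Proof.
apply: measurable_funTS; apply/measurable_EFinP.
exact: measurable_jacobi_weight.
Qed.

Let weight_ge0 alpha beta (y : R) : (0 <= (jacobi_weight alpha beta y)%:E)%E.
Proof. by rewrite lee_fin jacobi_weight_ge0. Qed.

Lemma jacobi_opp alpha beta (A : set R) : measurable A ->
  jacobi alpha beta (-%R @^-1` A) = jacobi beta alpha A.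
Proof.
move=> mA; have mA1 : measurable (A `&` `[-1, 1]) by exact: measurableI.
(* Lebesgue measure is its own image under [y -> -y], so the reflection becomes a change of
   variables. *)
have -> : jacobi beta alpha A =
    (\int[pushforward mu (-%R : R -> measurableTypeR R)]_(y in
       A `&` `[(-1)%R, 1%R]) (jacobi_weight beta alpha y)%:E)%E.
  by apply: eq_measure_integral => //= B mB _; exact/esym/lebesgue_measureN.
rewrite ge0_integral_pushforward//; last exact: measurable_weight.
rewrite /jacobi; congr integral; last first.
  by apply/funext => y/=; rewrite /jacobi_weight opprK mulrC.
apply/seteqP; split => y /=; rewrite !in_itv/= => -[Ay y1]; split=> //; lra.
Qed.

Lemma opp_ball11 x t : ball11 x t = -%R @^-1` ball11 (- x) t.
Proof.
rewrite /ball11; apply/seteqP; split => y /=; rewrite !in_itv/= => -[]; lra.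
Qed.

Lemma jacobi_ball11_le alpha beta : -1 < alpha ->
  exists2 K : R, 0 <= K & forall x t, 0 <= x <= 1 -> 0 < t <= 2^-1 ->
    (jacobi alpha beta (ball11 x t) <= (K * (t * (1 - x + t) `^ alpha))%:E)%E.
Proof.
move=> alpha1; set Q : R := 2 `^ `|beta|; have Q0 : 0 <= Q by exact: powR_ge0.
have a10 : 0 <= (alpha + 1)^-1 by rewrite invr_ge0; lra.
(* [Q] bounds [(1 + y)^beta], the middle factor comes from integrating [(1 - y)^alpha], and 2 from
   [q - p <= 2 * t]. *)
exists (Q * (1 + (alpha + 1)^-1) * 2); first by rewrite !mulr_ge0//; lra.
move=> x t /andP[x0 x1] /andP[t0 t12].
set p := x - t; set q := Num.min (x + t) 1.
have pq : p < q by rewrite /q /p lt_min; lra.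
have q1 : q <= 1 by rewrite /q ge_min lexx orbT.
have qt : q <= x + t by rewrite /q ge_min lexx.
apply: (@le_trans _ _ (\int[mu]_(y in `[p, q]) (jacobi_weight alpha beta y)%:E)%E).
  apply: ge0_subset_integral => //.
  - by apply: measurableI => //; exact: measurable_ball11.
  - exact: measurable_weight.
  move=> y [[]]/=; rewrite !in_itv/= => /andP[py yxt] /andP[_ y1] _.
  by rewrite py/= /q le_min yxt y1.
apply: (@le_trans _ _ (\int[mu]_(y in `[p, q]) (Q%:E * ((1 - y) `^ alpha)%:E))%E).
  apply: ge0_le_integral => //.
  - exact: measurable_weight.
  - by apply: measurable_funeM; exact: measurable_powR_onem.
  move=> y /=; rewrite in_itv/= => /andP[py yq].
  rewrite -EFinM lee_fin /jacobi_weight mulrC ler_wpM2r ?powR_ge0//.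
  (* Since [x >= 0] and [t <= 1/2], [1 + y] lies in [[1/2, 2]]. *)
  have : (1 + y) `^ beta <= Q * 1 `^ beta.
    by apply: powR_le_comparable; rewrite /p in py; lra.
  by rewrite powR1 mulr1.
rewrite ge0_integralZl_EFin//; last 2 first.
- by move=> y _; rewrite lee_fin powR_ge0.
- exact: measurable_powR_onem.
apply: le_trans (lee_wpmul2l _ (integral_powR_onem_le R alpha p q alpha1 pq q1)) _.
  by rewrite lee_fin.
rewrite -EFinM lee_fin -!mulrA ler_wpM2l//.
rewrite ler_wpM2l//; first lra.
have -> : 1 - p = 1 - x + t by rewrite /p; ring.
rewrite mulrA ler_wpM2r ?powR_ge0//; rewrite /p; lra.
Qed.

(** On [[x - t, x - t/2]], which stays inside [[-1, 1]] and away from 1, [1 - y] is within a factor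
    2 of [1 - x + t], and [1 + y] within a factor 2 of 1. The length [t/2] accounts for the
    remaining [1/2] in the constant. *)
Lemma jacobi_ball11_ge alpha beta :
  exists2 k : R, 0 < k & forall x t, 0 <= x <= 1 -> 0 < t <= 2^-1 ->
    ((k * (t * (1 - x + t) `^ alpha))%:E <= jacobi alpha beta (ball11 x t))%E.
Proof.
set P : R := 2 `^ `|alpha|; have P0 : 0 < P by exact: powR_gt0.
set Q : R := 2 `^ `|beta|; have Q0 : 0 < Q by exact: powR_gt0.
exists ((P * Q)^-1 / 2); first by rewrite divr_gt0// invr_gt0 mulr_gt0.
move=> x t /andP[x0 x1] /andP[t0 t12].
have -> : (P * Q)^-1 / 2 * (t * (1 - x + t) `^ alpha) =
    (P * Q)^-1 * (1 - x + t) `^ alpha * (x - t / 2 - (x - t)) by field; lra.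
rewrite -integral_cst_itv; last lra.
apply: (@le_trans _ _ (\int[mu]_(y in `[(x - t)%R, (x - t / 2)%R])
    (jacobi_weight alpha beta y)%:E)%E).
  apply: ge0_le_integral => //.
  - by move=> y _; rewrite lee_fin mulr_ge0 ?powR_ge0// invr_ge0 mulr_ge0 ?ltW.
  - exact: measurable_weight.
  move=> y /=; rewrite in_itv/= => /andP[ty yt].
  rewrite lee_fin ler_pdivrMl ?mulr_gt0//.
  have Ha : (1 - x + t) `^ alpha <= P * (1 - y) `^ alpha.
    by apply: powR_le_comparable; lra.
  have Hb : 1 <= Q * (1 + y) `^ beta.
    have : 1 `^ beta <= Q * (1 + y) `^ beta by apply: powR_le_comparable; lra.
    by rewrite powR1.
  apply: le_trans Ha _; rewrite /jacobi_weight mulrACA ler_peMr//.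
  by rewrite mulr_ge0 ?powR_ge0 ?ltW.
apply: ge0_subset_integral => //.
  - by apply: measurableI => //; exact: measurable_ball11.
  - exact: measurable_weight.
move=> y /=; rewrite /ball11 /= !in_itv/= => /andP[ty yt]; split; [split|]; lra.
Qed.

(** [[-1, 1]] is the union of [[0, 1]], the ball of centre and radius [1/2], and its mirror image,
    to which the upper bound applies with the exponents exchanged. *)
Lemma jacobi_fin alpha beta : -1 < alpha -> -1 < beta ->
  exists2 M : R, 0 <= M & (jacobi alpha beta `[(-1)%R, 1%R] <= M%:E)%E.
Proof.
move=> alpha1 beta1.
have [K K0 HK] := jacobi_ball11_le alpha beta alpha1.
have [L L0 HL] := jacobi_ball11_le beta alpha beta1.
have h0 : 0 <= (2^-1 : R) <= 1 by lra.
have h1 : 0 < (2^-1 : R) <= 2^-1 by lra.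
exists (K * (2^-1 * (1 - 2^-1 + 2^-1) `^ alpha) +
  L * (2^-1 * (1 - 2^-1 + 2^-1) `^ beta)).
  by rewrite addr_ge0// mulr_ge0// mulr_ge0 ?powR_ge0//; lra.
have := HK _ _ h0 h1; have := HL _ _ h0 h1.
rewrite -jacobi_opp// => HN HP.
have mN : measurable (-%R @^-1` ball11 2^-1 2^-1).
  by rewrite -[2^-1 in X in ball11 X _]opprK -opp_ball11.
rewrite EFinD; apply: le_trans (leeD HP HN).
apply: le_trans (measureU2 (jacobi alpha beta) (measurable_ball11 _ _) mN).
apply: le_measure; rewrite ?inE//; first exact: measurableU.
move=> y /=; rewrite /ball11 /= !in_itv/= => y1.
by have [y0|y0] := leP 0 y; [left|right]; split; lra.
Qed.

(** * The doubling inequality *)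

Lemma jacobi_doubling_ge0 alpha beta : -1 < alpha -> -1 < beta ->
  exists2 C : R, 0 <= C & forall x t, 0 <= x <= 1 -> 0 < t ->
    (jacobi alpha beta (ball11 x (2 * t)) <=
     C%:E * jacobi alpha beta (ball11 x t))%E.
Proof.
move=> alpha1 beta1.
have [K K0 HK] := jacobi_ball11_le alpha beta alpha1.
have [k k0 Hk] := jacobi_ball11_ge alpha beta.
have [M M0 HM] := jacobi_fin alpha beta alpha1 beta1.
set P : R := 2 `^ `|alpha|; have P0 : 0 < P by exact: powR_gt0.
set Q : R := 4 `^ `|alpha|; have Q0 : 0 < Q by exact: powR_gt0.
(* [C1] serves [t <= 1/4], where the upper bound applies at radius [2 * t <= 1/2]; [C2] serves
   [t > 1/4], as total mass over a lower bound at radius [1/4]. *)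
pose C1 := 2 * K * P / k; pose C2 := M * 4 * Q / k.
have C10 : 0 <= C1 by apply: divr_ge0; [rewrite !mulr_ge0// ltW|exact: ltW].
have C20 : 0 <= C2 by apply: divr_ge0; [rewrite !mulr_ge0// ltW|exact: ltW].
exists (C1 + C2); first exact: addr_ge0.
move=> x t x01 t0.
have [t14|t14] := leP t 4^-1.
  apply: (@le_trans _ _ (C1%:E * jacobi alpha beta (ball11 x t))%E); last first.
    by rewrite lee_wpmul2r ?measure_ge0// lee_fin lerDl.
  apply: (@le_trans _ _ (C1%:E * (k * (t * (1 - x + t) `^ alpha))%:E)%E); last first.
    by apply: lee_wpmul2l; [rewrite lee_fin|apply: Hk => //; lra].
  apply: le_trans (HK x (2 * t) x01 _) _; first lra.
  rewrite -EFinM lee_fin.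
  have -> : C1 * (k * (t * (1 - x + t) `^ alpha)) =
      K * (2 * t * (P * (1 - x + t) `^ alpha)) by rewrite /C1; field; lra.
  rewrite ler_wpM2l// ler_wpM2l//; first lra.
  (* [1 - x + 2 * t] lies between [1 - x + t] and its double. *)
  by apply: powR_le_comparable; lra.
apply: (@le_trans _ _ M%:E).
  by apply: le_trans HM; apply: le_measure; rewrite ?inE//; exact: subIsetr.
apply: (@le_trans _ _ (C2%:E * jacobi alpha beta (ball11 x t))%E); last first.
  by rewrite lee_wpmul2r ?measure_ge0// lee_fin lerDr.
apply: (@le_trans _ _ (C2%:E * (k * (4^-1 * (1 - x + 4^-1) `^ alpha))%:E)%E).
  rewrite -EFinM lee_fin.
  have -> : C2 * (k * (4^-1 * (1 - x + 4^-1) `^ alpha)) =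
      M * (Q * (1 - x + 4^-1) `^ alpha) by rewrite /C2; field; lra.
  rewrite ler_peMr//.
  (* [1 - x + 1/4] lies in [[1/4, 5/4]], hence within a factor 4 of 1. *)
  have : 1 `^ alpha <= Q * (1 - x + 4^-1) `^ alpha.
    by apply: powR_le_comparable; lra.
  by rewrite powR1.
apply: lee_wpmul2l; first by rewrite lee_fin.
apply: le_trans (Hk x 4^-1 x01 _) _; first lra.
apply: le_measure; rewrite ?inE//.
move=> y; rewrite /ball11/= !in_itv/= => -[? ?]; split; lra.
Qed.

End jacobi_balls.

Theorem theorem3p3 (R : realType) (alpha beta : R)
    (halpha : -1 < alpha) (hbeta : -1 < beta) :
  doubling (jacobi alpha beta).
Proof.
have [C C0 HC] := jacobi_doubling_ge0 R alpha beta halpha hbeta.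
have [D D0 HD] := jacobi_doubling_ge0 R beta alpha hbeta halpha.
exists (C + D) => x t; rewrite in_itv/= => /andP[x1 x2] t0.
change (jacobi alpha beta (ball11 R x (2 * t)) <=
  (C + D)%:E * jacobi alpha beta (ball11 R x t))%E.
have [x0|x0] := leP 0 x.
  apply: le_trans (HC x t _ t0) _; first lra.
  by rewrite lee_wpmul2r ?measure_ge0// lee_fin lerDl.
(* For [x < 0], reflect both balls: the centre becomes [- x] in [[0, 1]] and the constant [D] of the
   exchanged exponents applies. *)
rewrite !(opp_ball11 R x) !jacobi_opp; do ?exact: measurable_ball11.
apply: le_trans (HD (- x) t _ t0) _; first lra.
by rewrite lee_wpmul2r ?measure_ge0// lee_fin lerDr.
Qed.
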